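(* (a) Let $V$ be a crossed module, $M$ an abelian $\pi_0(V)$-module, and $z^3\in Z^3_{\mathrm{cpt}}(\pi_0(V),\pi_1(V))$ a componentwise pointed $3$-cocycle whose class in $H^3_{\mathrm{cpt}}(\pi_0(V),\pi_1(V))$ equals the first Postnikov invariant $k^3(V)$. Then \[H^2(V,M)\cong H^2\big((\pi_0(V),\pi_1(V),z^3),M\big)=Z^2/B^2,\] where $Z^2=\{(\varphi,c)\in \operatorname{Hom}_{\pi_0(V)}(\pi_1(V),M)\times C^2_{\mathrm{cpt}}(\pi_0(V),M)\;:\;\varphi\circ z^3=dc\}$ and $B^2=\{0\}\times B^2_{\mathrm{cpt}}(\pi_0(V),M)$. (b) Let $G$ be a simplicial group, $M$ an abelian $\pi_0(G)$-module, and $z^3\in Z^3_{\mathrm{cpt}}(\pi_0(G),\pi_1(G))$ a componentwise pointed $3$-cocycle whose class equals the first Postnikov invariant $k^3(G)$. Then \[H^2(G,M)\cong H^2\big((\pi_0(G),\pi_1(G),z^3),M\big).\]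
   Context: Group cohomology conventions: for a group $\Pi$ and abelian $\Pi$-module $A$ (written additively; if $A$ is written multiplicatively read $0$ as $1$), $C^n(\Pi,A)=\mathrm{Map}(\Pi^n,A)$ with differential $(dc)(g_n,\dots,g_0)=c(g_n,\dots,g_1)+\sum_{k=1}^n(-1)^k c(g_n,\dots,g_{k+1},g_kg_{k-1},g_{k-2},\dots,g_0)+(-1)^{n+1}g_n\cdot c(g_{n-1},\dots,g_0)$; $Z^n,B^n,H^n$ are cocycles, coboundaries, cohomology (this computes ordinary group cohomology). A cochain is componentwise pointed if it vanishes whenever some argument equals $1$; $C^n_{\mathrm{cpt}}$ denotes these, $Z^n_{\mathrm{cpt}}=Z^n\cap C^n_{\mathrm{cpt}}$, $B^n_{\mathrm{cpt}}=B^n\cap C^n_{\mathrm{cpt}}$, $H^n_{\mathrm{cpt}}=Z^n_{\mathrm{cpt}}/B^n_{\mathrm{cpt}}$. Crossed modules: a crossed module $V$ is a group $G_V$, a group $M_V$ with a left action of $G_V$ by automorphisms $(g,m)\mapsto {}^gm$, and a homomorphism $\mu:M_V\to G_V$ with $\mu({}^gm)=g\mu(m)g^{-1}$ and ${}^{\mu(n)}m=nmn^{-1}$. $\pi_0(V):=G_V/\mu(M_V)$, $\pi_1(V):=\ker\mu$ (central, abelian, a $\pi_0(V)$-module via the induced action; written multiplicatively). For $g\in G_V$, $\bar g$ is its class in $\pi_0(V)$. For an abelian $\pi_0(V)$-module $M$, the cohomology $H^n(V,M)$ is defined as the cohomology of the simplicial group $\mathrm{Cosk}_1V$ (the nerve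 of the associated categorical group); in low degrees its cochain complex is: $C^0(V,M)=M$, $C^1(V,M)=\mathrm{Map}(G_V,M)$, $C^2(V,M)=\mathrm{Map}(M_V\times G_V\times G_V,M)$, $C^3(V,M)=\mathrm{Map}(M_V\times M_V\times G_V\times M_V\times G_V\times G_V,M)$ with $(dc)(g)=c-\bar g\cdot c$, $(dc)(m,h,g)=c(\mu(m)h)-c(hg)+\bar h\cdot c(g)$, $(dc)(p,n,k,m,h,g)=c(p,\mu(n)k,\mu(m)h)-c(pn,k,hg)+c(n\,{}^km,kh,g)-\bar k\cdot c(m,h,g)$. Simplicial groups: $G$ has groups $G_n$, faces $d_k:G_n\to G_{n-1}$, degeneracies $s_k:G_n\to G_{n+1}$. Moore complex $N_0G=G_0$, $N_nG=\bigcap_{k=1}^n\ker d_k$, differential $d_0$; $B_nNG:=d_0(N_{n+1}G)$ (normal in $G_n$); $\pi_0(G)=G_0/B_0NG$, $\pi_n(G)=(N_nG\cap\ker d_0)/B_nNG$. For $g\in G_n$ let $\langle g\rangle\in\pi_0(G)$ be the class of $d_1d_2\cdots d_n(g)$. For an abelian $\pi_0(G)$-module $M$: $C^n(G,M)=\mathrm{Map}(G_{n-1}\times\cdots\times G_0,M)$ with $(dc)(g_n,\dots,g_0)=c(d_0g_n,\dots,d_0g_1)+\sum_{k=1}^n(-1)^kc(d_kg_n,\dots,d_kg_{k+1},(d_kg_k)g_{k-1},g_{k-2},\dots,g_0)+(-1)^{n+1}\langle g_n\rangle\cdot c(g_{n-1},\dots,g_0)$, and $H^n(G,M)$ its cohomology.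 The crossed module segment $T^1G$: group part $G_0$, module part $N_1G/B_1NG$, $\mu(xB_1NG)=d_0x$, action ${}^g(xB_1NG)=s_0(g)xs_0(g)^{-1}B_1NG$; one has $\pi_i(T^1G)=\pi_i(G)$ for $i=0,1$. Postnikov invariant: for a crossed module $V$, choose a map $s^0:\pi_0(V)\to G_V$ with $s^0(1)=1$ and $\overline{s^0(p)}=p$, and a map $s^1:\mu(M_V)\to M_V$ with $s^1(1)=1$, $\mu\circ s^1=\mathrm{id}$. Put $Z^2(q,p)=s^1(s^0(q)s^0(p)s^0(qp)^{-1})$ and $z^3_V(r,q,p)=Z^2(r,q)Z^2(rq,p)Z^2(r,qp)^{-1}({}^{s^0(r)}Z^2(q,p))^{-1}\in\pi_1(V)$. Then $z^3_V\in Z^3_{\mathrm{cpt}}(\pi_0(V),\pi_1(V))$ and its class $k^3(V)$ is independent of choices; $k^3(G):=k^3(T^1G)$ for a simplicial group $G$. *)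

(* Defs.v *)
From HB Require Import structures.
From mathcomp Require Import all_boot all_algebra.
From Stdlib Require Import ClassicalEpsilon ProofIrrelevance
  FunctionalExtensionality PropExtensionality.

Set Implicit Arguments.
Unset Strict Implicit.
Unset Printing Implicit Defensive.

Record Grp := Grp_make {
  gcar :> Type;
  gmul : gcar -> gcar -> gcar;
  gone : gcar;
  ginv : gcar -> gcar;
  gmulA : forall x y z, gmul x (gmul y z) = gmul (gmul x y) z;
  gmul1g : forall x, gmul gone x = x;
  gmulg1 : forall x, gmul x gone = x;
  gmulVg : forall x, gmul (ginv x) x = gone;
  gmulgV : forall x, gmul x (ginv x) = gone }.

Arguments gmul {_} _ _.
Arguments gone {_}.
Arguments ginv {_} _.

Definition is_hom (G H : Grp) (f : G -> H) : Prop :=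
  forall x y, f (gmul x y) = gmul (f x) (f y).

Section GroupLemmas.
Variable G : Grp.
Implicit Types x y z : G.

Lemma mulKg x y : gmul (ginv x) (gmul x y) = y.
Proof. by rewrite gmulA gmulVg gmul1g. Qed.

Lemma mulVKg x y : gmul x (gmul (ginv x) y) = y.
Proof. by rewrite gmulA gmulgV gmul1g. Qed.

Lemma inv_uniq x y : gmul x y = gone -> ginv x = y.
Proof. by move=> H; rewrite -[ginv x]gmulg1 -H mulKg. Qed.

Lemma invgK x : ginv (ginv x) = x.
Proof. by apply: inv_uniq; rewrite gmulVg. Qed.

Lemma invMg x y : ginv (gmul x y) = gmul (ginv y) (ginv x).
Proof. by apply: inv_uniq; rewrite -!gmulA mulVKg gmulgV. Qed.

Lemma invg1 : ginv (@gone G) = gone.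
Proof. by apply: inv_uniq; rewrite gmul1g. Qed.

End GroupLemmas.

Lemma hom_one (G H : Grp) (f : G -> H) : is_hom f -> f gone = gone.
Proof.
move=> hf; have E : f gone = gmul (f gone) (f gone) by rewrite -hf gmul1g.
by rewrite -[LHS](mulKg (f gone)) -E gmulVg.
Qed.

Lemma hom_inv (G H : Grp) (f : G -> H) x : is_hom f -> f (ginv x) = ginv (f x).
Proof.
move=> hf; symmetry; apply: inv_uniq.
by rewrite -hf gmulgV (hom_one hf).
Qed.

Lemma sig_eq (T : Type) (P : T -> Prop) (a b : {x : T | P x}) :
  proj1_sig a = proj1_sig b -> a = b.
Proof. by case: a => x Hx; case: b => y Hy /= E; subst y; rewrite (proof_irrelevance _ Hx Hy). Qed.

Section SubGrp.
Variables (G : Grp) (P : G -> Prop).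
Hypotheses (P1 : P gone) (PM : forall x y, P x -> P y -> P (gmul x y))
           (PV : forall x, P x -> P (ginv x)).

Definition sub_car := {x : G | P x}.
Definition sub_mul (a b : sub_car) : sub_car :=
  exist P (gmul (proj1_sig a) (proj1_sig b)) (PM (proj2_sig a) (proj2_sig b)).
Definition sub_one : sub_car := exist P gone P1.
Definition sub_inv (a : sub_car) : sub_car :=
  exist P (ginv (proj1_sig a)) (PV (proj2_sig a)).

Lemma sub_mulA a b c : sub_mul a (sub_mul b c) = sub_mul (sub_mul a b) c.
Proof. by apply: sig_eq; rewrite /= gmulA. Qed.
Lemma sub_mul1g a : sub_mul sub_one a = a.
Proof. by apply: sig_eq; rewrite /= gmul1g. Qed.
Lemma sub_mulg1 a : sub_mul a sub_one = a.
Proof. by apply: sig_eq; rewrite /= gmulg1. Qed.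
Lemma sub_mulVg a : sub_mul (sub_inv a) a = sub_one.
Proof. by apply: sig_eq; rewrite /= gmulVg. Qed.
Lemma sub_mulgV a : sub_mul a (sub_inv a) = sub_one.
Proof. by apply: sig_eq; rewrite /= gmulgV. Qed.

Definition SubGrp : Grp :=
  Grp_make sub_mulA sub_mul1g sub_mulg1 sub_mulVg sub_mulgV.
End SubGrp.

Section QuotGrp.
Variables (G : Grp) (N : G -> Prop).

Definition qrel (x y : G) : Prop := N (gmul x (ginv y)).
Definition quot_car := {C : G -> Prop | exists x, C = qrel x}.
Definition qcl (x : G) : quot_car := exist _ (qrel x) (ex_intro _ x erefl).
Definition qrep (a : quot_car) : G :=
  proj1_sig (constructive_indefinite_description _ (proj2_sig a)).

Lemma qrepP a : proj1_sig a = qrel (qrep a).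
Proof. exact: (proj2_sig (constructive_indefinite_description _ (proj2_sig a))). Qed.

Lemma qcl_rep a : qcl (qrep a) = a.
Proof. by apply: sig_eq; rewrite /= -qrepP. Qed.

Lemma quot_ind (Pr : quot_car -> Prop) : (forall x, Pr (qcl x)) -> forall a, Pr a.
Proof. by move=> H a; rewrite -(qcl_rep a). Qed.

Hypotheses (N1 : N gone) (NM : forall x y, N x -> N y -> N (gmul x y))
           (NV : forall x, N x -> N (ginv x))
           (NJ : forall g x, N x -> N (gmul (gmul g x) (ginv g))).

Lemma qrel_refl x : qrel x x.
Proof. by rewrite /qrel gmulgV. Qed.
Lemma qrel_sym x y : qrel x y -> qrel y x.
Proof. by move=> /NV; rewrite /qrel invMg invgK. Qed.
Lemma qrel_trans x y z : qrel x y -> qrel y z -> qrel x z.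
Proof. by move=> H1 H2; have := NM H1 H2; rewrite -gmulA mulKg. Qed.

Lemma qcl_eqP x y : qcl x = qcl y <-> qrel x y.
Proof.
split.
  by move=> /(congr1 (@proj1_sig _ _)) /= ->; apply: qrel_refl.
move=> Hxy; apply: sig_eq => /=; apply: functional_extensionality => z.
apply: propositional_extensionality; split => H.
  exact: qrel_trans (qrel_sym Hxy) H.
exact: qrel_trans Hxy H.
Qed.

Lemma qrep_cl x : qrel (qrep (qcl x)) x.
Proof. by apply/qcl_eqP; rewrite qcl_rep. Qed.

Lemma qrelM x x' y y' : qrel x x' -> qrel y y' -> qrel (gmul x y) (gmul x' y').
Proof.
move=> Hx Hy; have := NM (NJ x Hy) Hx; rewrite /qrel invMg.
by rewrite -!gmulA mulKg.
Qed.

Lemma qrelV x x' : qrel x x' -> qrel (ginv x) (ginv x').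
Proof.
move=> Hx; have := NV (NJ (ginv x) Hx); rewrite /qrel invgK.
by rewrite -!gmulA mulKg !invMg invgK.
Qed.

Definition qmul (a b : quot_car) : quot_car := qcl (gmul (qrep a) (qrep b)).
Definition qone : quot_car := qcl gone.
Definition qinv (a : quot_car) : quot_car := qcl (ginv (qrep a)).

Lemma qmulE x y : qmul (qcl x) (qcl y) = qcl (gmul x y).
Proof. by apply/qcl_eqP; apply: qrelM; apply: qrep_cl. Qed.
Lemma qinvE x : qinv (qcl x) = qcl (ginv x).
Proof. by apply/qcl_eqP; apply: qrelV; apply: qrep_cl. Qed.

Lemma qmulA a b c : qmul a (qmul b c) = qmul (qmul a b) c.
Proof.
elim/quot_ind: a => x; elim/quot_ind: b => y; elim/quot_ind: c => z.
by rewrite !qmulE gmulA.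
Qed.
Lemma qmul1g a : qmul qone a = a.
Proof. by elim/quot_ind: a => x; rewrite /qone qmulE gmul1g. Qed.
Lemma qmulg1 a : qmul a qone = a.
Proof. by elim/quot_ind: a => x; rewrite /qone qmulE gmulg1. Qed.
Lemma qmulVg a : qmul (qinv a) a = qone.
Proof. by elim/quot_ind: a => x; rewrite qinvE qmulE gmulVg. Qed.
Lemma qmulgV a : qmul a (qinv a) = qone.
Proof. by elim/quot_ind: a => x; rewrite qinvE qmulE gmulgV. Qed.

Definition QuotGrp : Grp := Grp_make qmulA qmul1g qmulg1 qmulVg qmulgV.
End QuotGrp.

(* Data of a crossed module V = (G_V, M_V, action, mu).  The record bundles   *)
(* the fact that mu is a homomorphism and the equivariance                    *)
(* mu(^g m) = g mu(m) g^-1; the remaining axioms are in [xmod_axioms].        *)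
Record xmod := XMod {
  xG : Grp;
  xM : Grp;
  xmu : xM -> xG;
  xmu_hom : is_hom xmu;
  xact : xG -> xM -> xM;
  xmu_act : forall g m, xmu (xact g m) = gmul (gmul g (xmu m)) (ginv g) }.

Definition xmod_axioms (V : xmod) : Prop :=
  (forall g : xG V, is_hom (xact g)) /\
  (forall m : xM V, xact gone m = m) /\
  (forall (g h : xG V) (m : xM V), xact (gmul g h) m = xact g (xact h m)) /\
  (forall n m : xM V, xact (xmu n) m = gmul (gmul n m) (ginv n)).

Section XModPi.
Variable V : xmod.

Definition im_mu (g : xG V) : Prop := exists m, xmu m = g.

Lemma im_mu1 : im_mu gone.
Proof. exists gone; exact: (hom_one (@xmu_hom V)). Qed.
Lemma im_muM x y : im_mu x -> im_mu y -> im_mu (gmul x y).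
Proof. by move=> [m <-] [n <-]; exists (gmul m n); apply: xmu_hom. Qed.
Lemma im_muV x : im_mu x -> im_mu (ginv x).
Proof. by move=> [m <-]; exists (ginv m); apply: hom_inv (@xmu_hom V). Qed.
Lemma im_muJ g x : im_mu x -> im_mu (gmul (gmul g x) (ginv g)).
Proof. by move=> [m <-]; exists (xact g m); apply: xmu_act. Qed.

Definition pi0 : Grp := QuotGrp im_mu1 im_muM im_muV im_muJ.

Definition bar (g : xG V) : pi0 := @qcl (xG V) im_mu g.

Definition ker_mu (m : xM V) : Prop := xmu m = gone.

Lemma ker_mu1 : ker_mu gone.
Proof. exact: hom_one (@xmu_hom V). Qed.
Lemma ker_muM x y : ker_mu x -> ker_mu y -> ker_mu (gmul x y).
Proof. by rewrite /ker_mu (@xmu_hom V) => -> ->; rewrite gmul1g. Qed.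
Lemma ker_muV x : ker_mu x -> ker_mu (ginv x).
Proof. by rewrite /ker_mu (hom_inv _ (@xmu_hom V)) => ->; rewrite invg1. Qed.
Lemma ker_mu_act g x : ker_mu x -> ker_mu (xact g x).
Proof. by rewrite /ker_mu xmu_act => ->; rewrite gmulg1 gmulgV. Qed.

Definition pi1 : Grp := SubGrp ker_mu1 ker_muM ker_muV.

Definition pi1val (z : pi1) : xM V := proj1_sig (z : {m : xM V | ker_mu m}).

Definition pi1_act (p : pi0) (z : pi1) : pi1 :=
  exist ker_mu (xact (@qrep (xG V) im_mu p) (pi1val z))
        (ker_mu_act (@qrep (xG V) im_mu p) (proj2_sig (z : {m : xM V | ker_mu m}))).

End XModPi.

Definition is_module (P : Grp) (M : zmodType) (act : P -> M -> M) : Prop :=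
  (forall p x y, act p (x + y)%R = (act p x + act p y)%R) /\
  (forall x, act gone x = x) /\
  (forall p q x, act (gmul p q) x = act p (act q x)).

(* Cochains C^n(Pi, A) = Map(Pi^n, A) are curried functions; arguments are in *)
(* the order (g_n, ..., g_0) of the differential                              *)
(*  (dc)(g_n..g_0) = c(g_n..g_1) + sum_k (-1)^k c(.., g_k g_{k-1}, ..)        *)
(*                   + (-1)^(n+1) g_n . c(g_{n-1}..g_0).                       *)
Section GroupCochains.
Variables (P A : Type) (pmul : P -> P -> P) (add : A -> A -> A) (opp : A -> A)
          (act : P -> A -> A).

Definition gd1 (c : P -> A) : P -> P -> A := fun g1 g0 =>
  add (add (c g1) (opp (c (pmul g1 g0)))) (act g1 (c g0)).

Definition gd2 (c : P -> P -> A) : P -> P -> P -> A := fun g2 g1 g0 =>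
  add (add (add (c g2 g1) (opp (c g2 (pmul g1 g0)))) (c (pmul g2 g1) g0))
      (opp (act g2 (c g1 g0))).

Definition gd3 (c : P -> P -> P -> A) : P -> P -> P -> P -> A := fun g3 g2 g1 g0 =>
  add (add (add (add (c g3 g2 g1) (opp (c g3 g2 (pmul g1 g0))))
                (c g3 (pmul g2 g1) g0))
           (opp (c (pmul g3 g2) g1 g0)))
      (act g3 (c g2 g1 g0)).
End GroupCochains.

Definition cpt2 (P A : Type) (one : P) (zero : A) (c : P -> P -> A) : Prop :=
  forall g1 g0, g1 = one \/ g0 = one -> c g1 g0 = zero.
Definition cpt3 (P A : Type) (one : P) (zero : A) (c : P -> P -> P -> A) : Prop :=
  forall g2 g1 g0, g2 = one \/ g1 = one \/ g0 = one -> c g2 g1 g0 = zero.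

Definition Z3cpt (P A : Grp) (actA : P -> A -> A) (z : P -> P -> P -> A) : Prop :=
  cpt3 gone gone z /\
  forall g3 g2 g1 g0, gd3 gmul gmul ginv actA z g3 g2 g1 g0 = gone.

Section TripleH2.
Variables (P A : Grp) (actA : P -> A -> A) (z3 : P -> P -> P -> A)
          (M : zmodType) (actM : P -> M -> M).

Definition C2_triple := ((A -> M) * (P -> P -> M))%type.

Definition C2_triple_add (x y : C2_triple) : C2_triple :=
  (fun a => x.1 a + y.1 a, fun g h => x.2 g h + y.2 g h)%R.

Definition Z2_triple (x : C2_triple) : Prop :=
  let: (phi, c) := x in
  (forall a b, phi (gmul a b) = (phi a + phi b)%R) /\
  (forall p a, phi (actA p a) = actM p (phi a)) /\
  cpt2 gone 0%R c /\
  (forall r q p, phi (z3 r q p) =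
     gd2 gmul (fun u v : M => (u + v)%R) (fun u : M => (- u)%R) actM c r q p).

Definition B2_triple (x : C2_triple) : Prop :=
  let: (phi, c) := x in
  (forall a, phi a = 0%R) /\
  cpt2 gone 0%R c /\
  (exists e : P -> M, forall g1 g0,
     c g1 g0 = gd1 gmul (fun u v : M => (u + v)%R) (fun u : M => (- u)%R) actM e g1 g0).
End TripleH2.

(* Isomorphism of quotient groups Z_X/B_X ~= Z_Y/B_Y, induced by a map F     *)
(* that is additive on Z_X, maps Z_X to Z_Y, has F^-1(B_Y) /\ Z_X = B_X, and  *)
(* is surjective modulo B_Y.                                                  *)
Definition quot_iso (X Y : Type) (addX : X -> X -> X) (ZX BX : X -> Prop)
    (addY : Y -> Y -> Y) (ZY BY : Y -> Prop) : Prop :=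
  exists F : X -> Y,
    (forall x, ZX x -> ZY (F x)) /\
    (forall x x', ZX x -> ZX x' -> F (addX x x') = addY (F x) (F x')) /\
    (forall x, ZX x -> (BY (F x) <-> BX x)) /\
    (forall y, ZY y -> exists x, ZX x /\ exists y', BY y' /\ F x = addY y y').

Section XModH2.
Variables (V : xmod) (M : zmodType) (actM : pi0 V -> M -> M).

Definition C2_xmod := (xM V -> xG V -> xG V -> M)%type.

Definition C2_xmod_add (c c' : C2_xmod) : C2_xmod :=
  fun m h g => (c m h g + c' m h g)%R.

Definition xd1 (c : xG V -> M) : C2_xmod := fun m h g =>
  (c (gmul (xmu m) h) - c (gmul h g) + actM (bar h) (c g))%R.

Definition xd2 (c : C2_xmod) :
    xM V -> xM V -> xG V -> xM V -> xG V -> xG V -> M :=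
  fun p n k m h g =>
  (c p (gmul (xmu n) k) (gmul (xmu m) h) - c (gmul p n) k (gmul h g)
   + c (gmul n (xact k m)) (gmul k h) g - actM (bar k) (c m h g))%R.

Definition Z2_xmod (c : C2_xmod) : Prop :=
  forall p n k m h g, xd2 c p n k m h g = 0%R.

Definition B2_xmod (c : C2_xmod) : Prop :=
  exists e : xG V -> M, forall m h g, c m h g = xd1 e m h g.
End XModH2.

Section Postnikov.
Variable V : xmod.

(* s0 : pi_0(V) -> G_V a section with s0(1) = 1;  s1 : mu(M_V) -> M_V a       *)
(* section of mu with s1(1) = 1 (s1 is given as a map on all of G_V, only its  *)
(* values on mu(M_V) matter).                                                  *)
Definition post_sections (s0 : pi0 V -> xG V) (s1 : xG V -> xM V) : Prop :=
  s0 gone = gone /\ (forall p, @bar V (s0 p) = p) /\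
  s1 gone = gone /\ (forall m, xmu (s1 (xmu m)) = xmu m).

Definition post_Z2 (s0 : pi0 V -> xG V) (s1 : xG V -> xM V) (q p : pi0 V) : xM V :=
  s1 (gmul (gmul (s0 q) (s0 p)) (ginv (s0 (gmul q p)))).

Definition post_z3 (s0 : pi0 V -> xG V) (s1 : xG V -> xM V) (r q p : pi0 V) : xM V :=
  let Z := post_Z2 s0 s1 in
  gmul (gmul (gmul (Z r q) (Z (gmul r q) p)) (ginv (Z r (gmul q p))))
       (ginv (xact (s0 r) (Z q p))).

(* the class of z3 in H^3_cpt(pi_0(V), pi_1(V)) is k^3(V):                   *)
(* z3 . (z^3_V)^-1 lies in B^3_cpt = B^3 /\ C^3_cpt for some choice s0, s1.  *)
Definition class_is_k3 (z3 : pi0 V -> pi0 V -> pi0 V -> pi1 V) : Prop :=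
  exists (s0 : pi0 V -> xG V) (s1 : xG V -> xM V),
    post_sections s0 s1 /\
    exists b : pi0 V -> pi0 V -> pi1 V,
      let db := gd2 gmul gmul ginv (@pi1_act V) b in
      cpt3 gone gone db /\
      forall r q p,
        pi1val (db r q p) = gmul (pi1val (z3 r q p)) (ginv (post_z3 s0 s1 r q p)).
End Postnikov.

(* sface n i = d_i : G_{n+1} -> G_n  (0 <= i <= n+1),                        *)
(* sdegen n i = s_i : G_n -> G_{n+1} (0 <= i <= n).                          *)
Unset Implicit Arguments.
Record sgrp := SGrp {
  sG : nat -> Grp;
  sface : forall n : nat, nat -> sG n.+1 -> sG n;
  sdegen : forall n : nat, nat -> sG n -> sG n.+1;
  sface_hom : forall n i, (i <= n.+1)%N -> is_hom (sface n i);
  sdegen_hom : forall n i, (i <= n)%N -> is_hom (sdegen n i);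
  s_dd : forall n i j (x : sG n.+2), (i < j)%N -> (j <= n.+2)%N ->
    sface n i (sface n.+1 j x) = sface n j.-1 (sface n.+1 i x);
  s_ds_lt : forall n i j (x : sG n.+1), (i < j)%N -> (j <= n.+1)%N ->
    sface n.+1 i (sdegen n.+1 j x) = sdegen n j.-1 (sface n i x);
  s_ds_eq : forall n j (x : sG n), (j <= n)%N -> sface n j (sdegen n j x) = x;
  s_ds_eq1 : forall n j (x : sG n), (j <= n)%N -> sface n j.+1 (sdegen n j x) = x;
  s_ds_gt : forall n i j (x : sG n.+1), (j.+1 < i)%N -> (i <= n.+2)%N ->
    sface n.+1 i (sdegen n.+1 j x) = sdegen n j (sface n i.-1 x);
  s_ss : forall n i j (x : sG n), (i <= j)%N -> (j <= n)%N ->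
    sdegen n.+1 i (sdegen n j x) = sdegen n.+1 j.+1 (sdegen n i x) }.
Set Implicit Arguments.
Arguments sface {_} n i _.
Arguments sdegen {_} n i _.

Section T1.
Variable G : sgrp.

Local Notation d n i := (@sface G n i).
Local Notation s n i := (@sdegen G n i).

Definition N1pred (x : sG G 1) : Prop := d 0 1 x = gone.

Lemma d01_hom : is_hom (d 0 1). Proof. exact: sface_hom. Qed.
Lemma d00_hom : is_hom (d 0 0). Proof. exact: sface_hom. Qed.
Lemma d10_hom : is_hom (d 1 0). Proof. exact: sface_hom. Qed.
Lemma d11_hom : is_hom (d 1 1). Proof. exact: sface_hom. Qed.
Lemma d12_hom : is_hom (d 1 2). Proof. exact: sface_hom. Qed.
Lemma s00_hom : is_hom (s 0 0). Proof. exact: sdegen_hom. Qed.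
Lemma s10_hom : is_hom (s 1 0). Proof. exact: sdegen_hom. Qed.

Lemma conj1 (H : Grp) (x : H) : gmul (gmul x gone) (ginv x) = gone.
Proof. by rewrite gmulg1 gmulgV. Qed.

Lemma hom_conj (H K : Grp) (f : H -> K) x y : is_hom f ->
  f (gmul (gmul x y) (ginv x)) = gmul (gmul (f x) (f y)) (ginv (f x)).
Proof. by move=> hf; rewrite !hf (hom_inv _ hf). Qed.

Lemma N1_1 : N1pred gone. Proof. exact: hom_one d01_hom. Qed.
Lemma N1_M x y : N1pred x -> N1pred y -> N1pred (gmul x y).
Proof. by rewrite /N1pred d01_hom => -> ->; rewrite gmul1g. Qed.
Lemma N1_V x : N1pred x -> N1pred (ginv x).
Proof. by rewrite /N1pred (hom_inv _ d01_hom) => ->; rewrite invg1. Qed.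

Definition N1grp : Grp := SubGrp N1_1 N1_M N1_V.
Definition N1val (y : N1grp) : sG G 1 := proj1_sig (y : {x : sG G 1 | N1pred x}).

Definition N2pred (b : sG G 2) : Prop := d 1 1 b = gone /\ d 1 2 b = gone.
Definition B1pred (y : N1grp) : Prop :=
  exists b : sG G 2, N2pred b /\ d 1 0 b = N1val y.

Lemma B1_1 : B1pred gone.
Proof.
exists gone; split; last exact: hom_one d10_hom.
by split; [exact: hom_one d11_hom | exact: hom_one d12_hom].
Qed.
Lemma B1_M x y : B1pred x -> B1pred y -> B1pred (gmul x y).
Proof.
move=> [b [[Hb1 Hb2] Hb0]] [c [[Hc1 Hc2] Hc0]]; exists (gmul b c).
rewrite /N2pred d11_hom d12_hom d10_hom Hb1 Hb2 Hc1 Hc2 Hb0 Hc0 gmul1g.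
by split.
Qed.
Lemma B1_V x : B1pred x -> B1pred (ginv x).
Proof.
move=> [b [[Hb1 Hb2] Hb0]]; exists (ginv b).
rewrite /N2pred (hom_inv _ d11_hom) (hom_inv _ d12_hom) (hom_inv _ d10_hom).
by rewrite Hb1 Hb2 Hb0 invg1.
Qed.
Lemma B1_J g x : B1pred x -> B1pred (gmul (gmul g x) (ginv g)).
Proof.
move=> [b [[Hb1 Hb2] Hb0]]; exists (gmul (gmul (s 1 0 (N1val g)) b) (ginv (s 1 0 (N1val g)))).
rewrite /N2pred !(hom_conj _ _ d11_hom) !(hom_conj _ _ d12_hom) (hom_conj _ _ d10_hom).
rewrite Hb1 Hb2 Hb0 !conj1 s_ds_eq //.
Qed.

Definition T1M : Grp := QuotGrp B1_1 B1_M B1_V B1_J.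

Definition T1rep (q : T1M) : N1grp := @qrep N1grp B1pred q.

Definition T1mu (q : T1M) : sG G 0 := d 0 0 (N1val (T1rep q)).

Lemma T1mu_cl (x : N1grp) : d 0 0 (N1val (@qrep N1grp B1pred (@qcl N1grp B1pred x))) = d 0 0 (N1val x).
Proof.
have [b [[Hb1 Hb2] Hb0]] := qrep_cl B1_1 B1_M B1_V x.
have E : d 0 0 (d 1 0 b) = gone.
  by rewrite -(@s_dd G 0 0 1) // Hb1; apply: hom_one d00_hom.
move: E; rewrite Hb0 /N1val /= d00_hom (hom_inv _ d00_hom) => E.
by rewrite -[LHS]gmulg1 -[gone in LHS](gmulVg (d 0 0 (proj1_sig x))) gmulA E gmul1g.
Qed.

Lemma T1mu_hom : is_hom T1mu.
Proof.
move=> a b; rewrite /T1mu /T1rep /= /qmul T1mu_cl.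
by rewrite /N1val /= d00_hom.
Qed.

Lemma N1_conj (g : sG G 0) (y : N1grp) :
  N1pred (gmul (gmul (s 0 0 g) (N1val y)) (ginv (s 0 0 g))).
Proof.
rewrite /N1pred (hom_conj _ _ d01_hom).
by rewrite (proj2_sig (y : {x : sG G 1 | N1pred x})) conj1.
Qed.

Definition T1act (g : sG G 0) (q : T1M) : T1M :=
  @qcl N1grp B1pred (exist N1pred _ (N1_conj g (T1rep q))).

Lemma T1mu_act g q : T1mu (T1act g q) = gmul (gmul g (T1mu q)) (ginv g).
Proof.
rewrite /T1mu /T1act T1mu_cl /N1val /= (hom_conj _ _ d00_hom).
by rewrite s_ds_eq.
Qed.

Definition T1 : xmod := @XMod (sG G 0) T1M T1mu T1mu_hom T1act T1mu_act.

End T1.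

(* pi_0(G) and pi_1(G) of a simplicial group, via pi_i(G) = pi_i(T^1 G) *)
Definition spi0 (G : sgrp) : Grp := pi0 (T1 G).
Definition spi1 (G : sgrp) : Grp := pi1 (T1 G).

Section SimplH2.
Variables (G : sgrp) (M : zmodType) (actM : spi0 G -> M -> M).

(* <g> = class of d_1 ... d_n g in pi_0(G) *)
Definition sbr1 (g1 : sG G 1) : spi0 G := @bar (T1 G) (sface 0 1 g1).
Definition sbr2 (g2 : sG G 2) : spi0 G := @bar (T1 G) (sface 0 1 (sface 1 2 g2)).

Definition C2_sgrp := (sG G 1 -> sG G 0 -> M)%type.

Definition C2_sgrp_add (c c' : C2_sgrp) : C2_sgrp :=
  fun g1 g0 => (c g1 g0 + c' g1 g0)%R.

Definition sd1 (c : sG G 0 -> M) : C2_sgrp := fun g1 g0 =>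
  (c (sface 0 0 g1) - c (gmul (sface 0 1 g1) g0) + actM (sbr1 g1) (c g0))%R.

Definition sd2 (c : C2_sgrp) : sG G 2 -> sG G 1 -> sG G 0 -> M := fun g2 g1 g0 =>
  (c (sface 1 0 g2) (sface 0 0 g1) - c (sface 1 1 g2) (gmul (sface 0 1 g1) g0)
   + c (gmul (sface 1 2 g2) g1) g0 - actM (sbr2 g2) (c g1 g0))%R.

Definition Z2_sgrp (c : C2_sgrp) : Prop := forall g2 g1 g0, sd2 c g2 g1 g0 = 0%R.

Definition B2_sgrp (c : C2_sgrp) : Prop :=
  exists e : sG G 0 -> M, forall g1 g0, c g1 g0 = sd1 e g1 g0.
End SimplH2.

(* Main.v *)
Require Import Defs.
From mathcomp Require Import all_boot all_algebra.
From Stdlib Require Import FunctionalExtensionality.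

(* A normalised 2-cocycle c of V splits as c(m,h,g) = f(m,h) + gamma(h,g), where
   gamma is a group 2-cocycle on G_V and f is determined by F(m) = f(m,1): thus c
   is an extension E of G_V by M with an equivariant lift of mu to M_V -> E.
   Restricting the lift to pi_1 gives phi, and lifting the section s^0 to E gives
   a 2-cochain tau with d tau = phi o z_V.  If z3 = db . z_V, then
   (phi, tau + phi o b), with b made pointed, is the image of c.  The extension is
   rebuilt from (phi, tau) in the coordinates g = mu(m_g) s^0(gbar), using an
   extension psi of phi to M_V.
   For a simplicial group G, every 2-cocycle is invariant under left translation of
   its first argument by B_1, so 2-cocycles and 2-coboundaries of G are exactly
   those of T^1 G. *)

Set Implicit Arguments.
Unset Strict Implicit.
Unset Printing Implicit Defensive.
Import GRing.Theory Defs.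

Local Notation "x ** y" := (gmul x y) (at level 40, left associativity).
Local Open Scope ring_scope.

(* The [ring] tactic needs a ring structure; [zmod] decides linear identities in a
   zmodType by comparing integer coefficients of reified sums. *)
Inductive zexp := ZAtom of nat | ZZero | ZAdd of zexp & zexp | ZOpp of zexp.

Section Zexp.
Variables (M : zmodType) (env : seq M).

Fixpoint zeval e : M :=
  match e with
  | ZAtom i => nth 0 env i
  | ZZero => 0
  | ZAdd a b => zeval a + zeval b
  | ZOpp a => - zeval a
  end.

Fixpoint zcoef e (i : nat) : int :=
  match e with
  | ZAtom j => (i == j)%:Z
  | ZZero => 0
  | ZAdd a b => zcoef a i + zcoef b i
  | ZOpp a => - zcoef a i
  end.

Lemma zevalE e : zeval e = \sum_(i < size env) nth 0 env i *~ zcoef e i.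
Proof.
elim: e => [j||a IHa b IHb|a IHa] /=.
- have [ltj|gej] := ltnP j (size env).
    rewrite (bigD1 (Ordinal ltj)) //= eqxx big1 ?addr0 // => i /negPf nij.
    by have -> : (i == j :> nat) = false by rewrite -nij.
  (* An atom outside [env] evaluates to the default 0, and its coefficient is 0 at every index below
     [size env]. *)
  rewrite nth_default // big1 // => i _.
  by rewrite (ltn_eqF (leq_trans (ltn_ord i) gej)).
- by rewrite big1 // => i _; rewrite mulr0z.
- by rewrite IHa IHb -big_split; apply: eq_bigr => i _; rewrite mulrzDr.
- by rewrite IHa -sumrN; apply: eq_bigr => i _; rewrite mulrNz.
Qed.

Lemma zexp_eq e1 e2 :
  all (fun i => zcoef e1 i == zcoef e2 i) (iota 0 (size env)) ->
  zeval e1 = zeval e2.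
Proof.
move=> /allP H; rewrite !zevalE; apply: eq_bigr => i _; congr (_ *~ _).
by apply/eqP/H; rewrite mem_iota /=.
Qed.
End Zexp.

Ltac zm_find x env :=
  match env with
  | x :: _ => constr:(0%N)
  | _ :: ?env' => let n := zm_find x env' in constr:(S n)
  end.
Ltac zm_mem x env :=
  match env with
  | x :: _ => constr:(true)
  | _ :: ?env' => zm_mem x env'
  | _ => constr:(false)
  end.
Ltac zm_env e env :=
  match e with
  | (?a + ?b)%R => let env := zm_env a env in zm_env b env
  | (- ?a)%R => zm_env a env
  | 0%R => env
  | _ => match zm_mem e env with true => env | false => constr:(e :: env) end
  end.
Ltac zm_reify e env :=
  match e with
  | (?a + ?b)%R =>
      let a' := zm_reify a env in let b' := zm_reify b env in constr:(ZAdd a' b')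
  | (- ?a)%R => let a' := zm_reify a env in constr:(ZOpp a')
  | 0%R => constr:(ZZero)
  | _ => let i := zm_find e env in constr:(ZAtom i)
  end.
Ltac zmod :=
  match goal with
  | |- @eq ?T ?l ?r =>
      let env := zm_env l (@nil T) in
      let env := zm_env r env in
      let l' := zm_reify l env in
      let r' := zm_reify r env in
      exact (@zexp_eq _ env l' r' isT)
  end.

(** Lets a goal follow from known equations: [a = b] is a sum of them, suitably oriented, and the
    difference identity is left to [zmod]. *)
Lemma eq_of_subr (M : zmodType) (a b x y : M) :
  a = b -> (x - y = a - b)%R -> x = y.
Proof. by move=> -> /eqP; rewrite subrr subr_eq0 => /eqP. Qed.

(** * Peiffer calculus and the action of pi_0 on pi_1 *)

Section CrossedModule.
Variables (V : xmod) (Vax : xmod_axioms V).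
Local Notation mu := (@xmu V).
Implicit Types (g h k : xG V) (m n x y : xM V) (p q r : pi0 V).

Lemma mu1 : mu gone = gone. Proof. exact: hom_one (@xmu_hom V). Qed.
Lemma muM m n : mu (m ** n) = mu m ** mu n. Proof. exact: xmu_hom. Qed.
Lemma muV m : mu (ginv m) = ginv (mu m). Proof. exact: hom_inv (@xmu_hom V). Qed.
Lemma actxM g m n : xact g (m ** n) = xact g m ** xact g n.
Proof. by case: Vax => H _; apply: H. Qed.
Lemma actx1 g : xact g gone = gone :> xM V.
Proof. by case: Vax => H _; apply: hom_one (H g). Qed.
Lemma act1x m : xact gone m = m.
Proof. by case: Vax => _ [H _]; apply: H. Qed.
Lemma actMx g h m : xact (g ** h) m = xact g (xact h m).
Proof. by case: Vax => _ [_ [H _]]; apply: H. Qed.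
Lemma peiffer n m : xact (mu n) m ** n = n ** m.
Proof. by case: Vax => _ [_ [_ H]]; rewrite H -gmulA gmulVg gmulg1. Qed.

Lemma mu_act g m : mu (xact g m) ** g = g ** mu m.
Proof. by rewrite xmu_act -gmulA gmulVg gmulg1. Qed.

Lemma barM g h : bar (g ** h) = bar g ** bar h.
Proof. by rewrite /bar -(qmulE (@im_mu1 V) (@im_muM V) (@im_muV V) (@im_muJ V)). Qed.

Lemma bar_eqP g h : bar g = bar h <-> exists m, mu m = g ** ginv h.
Proof. exact: (qcl_eqP (@im_mu1 V) (@im_muM V) (@im_muV V)). Qed.

Lemma bar_mu m : bar (mu m) = gone.
Proof. by apply/bar_eqP; exists m; rewrite invg1 gmulg1. Qed.

Lemma bar_muM m h : bar (mu m ** h) = bar h.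
Proof. by rewrite barM bar_mu gmul1g. Qed.

Lemma ker_central a x : ker_mu a -> a ** x = x ** a.
Proof. by move=> ka; rewrite -peiffer ka act1x. Qed.

Lemma ker_mulCA a x y : ker_mu a -> x ** (a ** y) = a ** (x ** y).
Proof. by move=> ka; rewrite !gmulA (ker_central x ka). Qed.

(** The image of [mu] acts by conjugation, which is trivial on the central [ker_mu]; so any
    representative of a class in pi_0 may be used. *)
Lemma act_ker g h a : bar g = bar h -> ker_mu a -> xact g a = xact h a.
Proof.
move=> /bar_eqP [m Em] ka.
have -> : g = mu m ** h by rewrite Em -gmulA gmulVg gmulg1.
have kb := ker_mu_act h ka.
rewrite actMx -[LHS]gmulg1 -[in LHS](gmulgV m) gmulA peiffer.
by rewrite -(ker_central _ kb) -gmulA gmulgV gmulg1.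
Qed.

Lemma pi1val_act g (a : pi1 V) : pi1val (pi1_act (bar g) a) = xact g (pi1val a).
Proof.
apply: act_ker; last exact: (proj2_sig a).
exact: (@qcl_rep (xG V) (@im_mu V)).
Qed.

Lemma pi1val_inj (a b : pi1 V) : pi1val a = pi1val b -> a = b.
Proof. exact: sig_eq. Qed.

Lemma pi1valP (a : pi1 V) : ker_mu (pi1val a).
Proof. exact: proj2_sig a. Qed.

Lemma mu_eq x y : mu x = mu y -> exists a : pi1 V, x = pi1val a ** y.
Proof.
move=> Exy; have ka : ker_mu (x ** ginv y) by rewrite /ker_mu muM muV Exy gmulgV.
by exists (exist _ _ ka); rewrite /= -gmulA gmulVg gmulg1.
Qed.

(** * Normalised 2-cocycles of a crossed module *)

Section Module.
Variables (M : zmodType) (actM : pi0 V -> M -> M) (Mmod : is_module actM).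

Lemma actMD p (u v : M) : actM p (u + v) = actM p u + actM p v.
Proof. by case: Mmod => H _; apply: H. Qed.
Lemma actM1 (u : M) : actM gone u = u.
Proof. by case: Mmod => _ [H _]; apply: H. Qed.
Lemma actMM p q (u : M) : actM (p ** q) u = actM p (actM q u).
Proof. by case: Mmod => _ [_ H]; apply: H. Qed.
Lemma actM0 p : actM p 0 = 0.
Proof. by apply: (@addrI _ (actM p 0)); rewrite -actMD !addr0. Qed.
Lemma actMN p (u : M) : actM p (- u) = - actM p u.
Proof. by apply: (@addrI _ (actM p u)); rewrite -actMD !subrr actM0. Qed.
Definition actME := (actMD, actMN, actM0).

(** The subtracted term is the coboundary of a constant 1-cochain, so the cohomology class is
    unchanged. *)
Definition normalised (c : C2_xmod V M) : C2_xmod V M :=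
  fun m h g => c m h g - actM (bar h) (c gone gone gone).

Lemma normalised_111 c : normalised c gone gone gone = 0.
Proof. by rewrite /normalised actM1 subrr. Qed.

Lemma normalised_Z2 c : Z2_xmod actM c -> Z2_xmod actM (normalised c).
Proof.
move=> Zc p n k m h g; apply: eq_of_subr (Zc p n k m h g) _.
rewrite /xd2 /normalised !actME bar_muM barM actMM; zmod.
Qed.

Section NormalisedCocycle.
Variables (c : C2_xmod V M) (Zc : Z2_xmod actM c) (c111 : c gone gone gone = 0).

Lemma coc_1k1 k : c gone k gone = 0.
Proof.
move: (Zc gone gone k gone gone gone).
by rewrite /xd2 actx1 !mu1 !(gmul1g, gmulg1) c111 actM0 subrr add0r subr0.
Qed.

Lemma coc_11g g : c gone gone g = 0.
Proof.
have := Zc gone gone gone gone gone g.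
rewrite /xd2 actx1 !mu1 !(gmul1g, gmulg1) c111 actM1 => H.
apply: eq_of_subr (esym H) _; zmod.
Qed.

Lemma coc_split m h g : c m h g = c m h gone + c gone h g.
Proof.
have := Zc m gone h gone gone g.
rewrite /xd2 actx1 !mu1 !(gmul1g, gmulg1) coc_11g actM0 => H.
apply: eq_of_subr (esym H) _; zmod.
Qed.

Lemma coc_gd2 k h g :
  c gone k h - c gone k (h ** g) + c gone (k ** h) g - actM (bar k) (c gone h g) = 0.
Proof.
by have := Zc gone gone k gone h g; rewrite /xd2 actx1 !mu1 !(gmul1g, gmulg1).
Qed.

Lemma coc_mulM m n k :
  c (m ** n) k gone = c m (mu n ** k) gone + c n k gone.
Proof.
have := Zc m n k gone gone gone.
rewrite /xd2 actx1 !mu1 !(gmul1g, gmulg1) c111 actM0 => H.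
apply: eq_of_subr (esym H) _; zmod.
Qed.

(** At [k = gone], where [coc_11g] removes the last term, this determines [c n h gone] from
    [c n gone gone] and the group cocycle [c gone]. *)
Lemma coc_mulG n k h :
  c n (k ** h) gone = c n k gone - c gone (mu n ** k) h + c gone k h.
Proof.
have := Zc gone n k gone h gone.
rewrite /xd2 actx1 !mu1 !(gmul1g, gmulg1) coc_1k1 actM0 (coc_split n k h) => H.
apply: eq_of_subr H _; zmod.
Qed.

(** Equivariance of the lift of [mu] to the extension, in cocycle form. *)
Lemma coc_act k m h :
  c (xact k m) (k ** h) gone =
  actM (bar k) (c m h gone) - c gone k (mu m ** h) + c gone k h.
Proof.
have := Zc gone gone k m h gone.
rewrite /xd2 !mu1 !(gmul1g, gmulg1) => H.
apply: eq_of_subr H _; zmod.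
Qed.

Lemma coc_ker a k : ker_mu a -> c a k gone = c a gone gone.
Proof.
move=> ka; have := coc_mulG a gone k.
by rewrite ka !gmul1g coc_11g subr0 addr0.
Qed.

Lemma coc_ker_hom (a b : xM V) : ker_mu b ->
  c (a ** b) gone gone = c a gone gone + c b gone gone.
Proof. by move=> kb; rewrite coc_mulM kb gmulg1. Qed.

Lemma coc_ker_act g a : ker_mu a ->
  c (xact g a) gone gone = actM (bar g) (c a gone gone).
Proof.
move=> ka; rewrite -(coc_ker g (ker_mu_act g ka)).
by have := coc_act g a gone; rewrite ka !gmulg1 coc_1k1 addr0 subr0.
Qed.

End NormalisedCocycle.

(** * Coordinates on G_V from the sections s^0 and s^1 *)

Section Sections.
Variables (s0 : pi0 V -> xG V) (s1 : xG V -> xM V) (Hs : post_sections s0 s1).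
Local Notation Z := (post_Z2 s0 s1).

Lemma s0_1 : s0 gone = gone. Proof. by case: Hs. Qed.
Lemma bar_s0 p : bar (s0 p) = p. Proof. by case: Hs => _ [H _]. Qed.
Lemma s1_1 : s1 gone = gone. Proof. by case: Hs => _ [_ []]. Qed.
Lemma mu_s1 m : mu (s1 (mu m)) = mu m. Proof. by case: Hs => _ [_ [_ H]]. Qed.
Lemma mu_s1_bar g h : bar g = bar h -> mu (s1 (g ** ginv h)) = g ** ginv h.
Proof. by move=> /bar_eqP [m <-]; apply: mu_s1. Qed.

Lemma mu_Z q p : mu (Z q p) ** s0 (q ** p) = s0 q ** s0 p.
Proof.
rewrite /post_Z2 mu_s1_bar ?barM ?bar_s0 //.
by rewrite -!gmulA gmulVg gmulg1.
Qed.

Lemma Z1p p : Z gone p = gone.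
Proof. by rewrite /post_Z2 s0_1 !gmul1g gmulgV s1_1. Qed.
Lemma Zq1 q : Z q gone = gone.
Proof. by rewrite /post_Z2 s0_1 !gmulg1 gmulgV s1_1. Qed.

(** The coordinate m_g in g = mu(m_g) s^0(gbar). *)
Definition lift_mu g : xM V := s1 (g ** ginv (s0 (bar g))).
Local Notation l := lift_mu.

Lemma mu_lift g : mu (l g) ** s0 (bar g) = g.
Proof. by rewrite /l mu_s1_bar ?bar_s0 // -gmulA gmulVg gmulg1. Qed.
Lemma lift_s0 p : l (s0 p) = gone.
Proof. by rewrite /l bar_s0 gmulgV s1_1. Qed.
Lemma mu_liftE g : mu (l g) = g ** ginv (s0 (bar g)).
Proof. by rewrite /l mu_s1_bar ?bar_s0. Qed.
Lemma mu_lift_mul m g : mu (l (mu m ** g)) = mu (m ** l g).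
Proof. by rewrite muM !mu_liftE bar_muM gmulA. Qed.

(** Equivariance moves s^0(hbar) past mu(m_g), and [Z] compares the product of sections with the
    section of the product. Only the images under [mu] agree; the elements of M_V may differ by
    pi_1. *)
Lemma mu_lift_mulG h g :
  mu (l (h ** g)) =
  mu (l h ** xact (s0 (bar h)) (l g) ** Z (bar h) (bar g)).
Proof.
rewrite mu_liftE -[in LHS](mu_lift h) -[in LHS](mu_lift g).
rewrite !muM barM !bar_muM !bar_s0.
rewrite gmulA -(gmulA (mu (l h))) -mu_act -!gmulA (gmulA (s0 _) (s0 _)) -mu_Z.
by rewrite -!gmulA gmulgV gmulg1.
Qed.

Lemma act_lift k x : xact k x ** l k = l k ** xact (s0 (bar k)) x.
Proof. by rewrite -[in X in xact X x](mu_lift k) actMx peiffer. Qed.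

Local Notation gd2M := (gd2 gmul (fun u v : M => u + v) (fun u : M => - u) actM).
Local Notation gd1M := (gd1 gmul (fun u v : M => u + v) (fun u : M => - u) actM).

Definition tau (c : C2_xmod V M) q p : M :=
  c (Z q p) (s0 (q ** p)) gone + c gone (s0 q) (s0 p).

Section TauOfCocycle.
Variables (c : C2_xmod V M) (Zc : Z2_xmod actM c) (c111 : c gone gone gone = 0).

Lemma tau_cpt2 : cpt2 gone 0 (tau c).
Proof.
move=> q p [->|->]; rewrite /tau ?Z1p ?Zq1 s0_1 ?(coc_1k1 Zc c111) add0r.
  exact: (coc_11g Zc c111).
by [].
Qed.

(* The cocycle c encodes an extension of G_V by M with a lift of mu; [tau] is
   the defect of the lift of [s0], and comparing both bracketings of a triple
   product of lifts gives the identity. *)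
Lemma gd2_tau (a : pi1 V) r q p : pi1val a = post_z3 s0 s1 r q p ->
  gd2M (tau c) r q p = c (pi1val a) gone gone.
Proof.
move=> Ea.
have ka : ker_mu (pi1val a) by exact: pi1valP.
(* [W] and [Z r q ** Z (r ** q) p] come from the two bracketings of s^0(r) s^0(q) s^0(p); they
   differ by the central element [a]. *)
pose W := xact (s0 r) (Z q p) ** Z r (q ** p).
have EW : pi1val a ** W = Z r q ** Z (r ** q) p.
  by rewrite Ea /post_z3 /W -!gmulA mulKg gmulVg gmulg1.
have E1 := coc_mulM Zc c111 (pi1val a) W (s0 (r ** (q ** p))).
rewrite EW (coc_ker Zc c111 _ ka) (coc_mulM Zc c111) in E1.
have muZ : mu (Z (r ** q) p) ** s0 (r ** (q ** p)) = s0 (r ** q) ** s0 p.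
  by rewrite gmulA mu_Z.
rewrite muZ in E1.
have E2 : c W (s0 (r ** (q ** p))) gone =
    c (xact (s0 r) (Z q p)) (s0 r ** s0 (q ** p)) gone
    + c (Z r (q ** p)) (s0 (r ** (q ** p))) gone.
  by rewrite /W (coc_mulM Zc c111) mu_Z.
rewrite (coc_act Zc) bar_s0 mu_Z in E2.
have E3 := coc_mulG Zc c111 (Z r q) (s0 (r ** q)) (s0 p).
rewrite mu_Z in E3.
have E4 := coc_gd2 Zc (s0 r) (s0 q) (s0 p).
rewrite bar_s0 in E4.
rewrite E2 E3 in E1.
rewrite /gd2 /tau !actMD.
rewrite -?gmulA in E1 E4 *.
apply: eq_of_subr (congr2 +%R E1 E4) _; zmod.
Qed.

End TauOfCocycle.

(** * The map from 2-cocycles of V to pairs (phi, c) *)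

Section Triple.
Variables (z3 : pi0 V -> pi0 V -> pi0 V -> pi1 V) (b : pi0 V -> pi0 V -> pi1 V).
Local Notation db := (gd2 gmul gmul ginv (@pi1_act V) b).
Hypotheses (db_cpt : cpt3 gone gone db)
  (dbE : forall r q p,
     pi1val (db r q p) = pi1val (z3 r q p) ** ginv (post_z3 s0 s1 r q p)).

Section Character.
Variables (phi : pi1 V -> M) (phiM : forall x y : pi1 V, phi (x ** y) = phi x + phi y)
  (phi_act : forall p a, phi (pi1_act p a) = actM p (phi a)).

Lemma character1 : phi gone = 0.
Proof. by apply: (@addrI _ (phi gone)); rewrite -phiM gmul1g addr0. Qed.
Lemma characterV a : phi (ginv a) = - phi a.
Proof. by apply: (@addrI _ (phi a)); rewrite -phiM gmulgV subrr character1. Qed.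

(* Only [db], not [b], is pointed; subtracting the coboundary of the constant
   [phi (b 1 1)] makes [phi \o b] pointed without changing its differential. *)
Definition corr q p : M := phi (b q p) - actM q (phi (b gone gone)).

Lemma phi_db r q p : phi (db r q p) =
  phi (b r q) - phi (b r (q ** p)) + phi (b (r ** q) p) - actM r (phi (b q p)).
Proof. by rewrite /gd2 !(phiM, characterV) phi_act. Qed.

Lemma gd2_corr r q p : gd2M corr r q p = phi (db r q p).
Proof. rewrite phi_db /gd2 /corr !actME !actMM; zmod. Qed.

(** Pointedness of [db] at (r, 1, p) expresses phi b(r,1) as r acting on phi b(1,p), so both are
    governed by phi b(1,1). *)
Lemma corr_cpt2 : cpt2 gone 0 corr.
Proof.
have E r p : phi (b r gone) = actM r (phi (b gone p)).
  have /(congr1 phi) := @db_cpt r gone p (or_intror (or_introl erefl)).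
  rewrite character1 phi_db gmul1g gmulg1 => H; apply: eq_of_subr H _; zmod.
move=> q p [->|->]; rewrite /corr; last by rewrite (E _ gone) subrr.
by rewrite (E gone p) !actM1 subrr.
Qed.

End Character.

Lemma corr0 (phi : pi1 V -> M) q p : (forall a, phi a = 0) -> corr phi q p = 0.
Proof. by move=> H; rewrite /corr !H actM0 subrr. Qed.

(** [post_z3] has values in [xM V]; solving [dbE] for it exhibits it as an element of pi_1. *)
Lemma z3E r q p : exists2 a : pi1 V, pi1val a = post_z3 s0 s1 r q p &
  z3 r q p = db r q p ** a.
Proof.
exists (ginv (db r q p) ** z3 r q p); last by rewrite mulVKg.
have -> : pi1val (ginv (db r q p) ** z3 r q p) =
    ginv (pi1val (db r q p)) ** pi1val (z3 r q p) by [].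
by rewrite dbE invMg invgK -gmulA gmulVg gmulg1.
Qed.

Definition to_triple (c : C2_xmod V M) : C2_triple (pi0 V) (pi1 V) M :=
  let c0 := normalised c in
  let phi := fun a => c0 (pi1val a) gone gone in
  (phi, fun q p => tau c0 q p + corr phi q p).

Lemma to_triple_Z2 c : Z2_xmod actM c -> Z2_triple (@pi1_act V) z3 actM (to_triple c).
Proof.
move=> /normalised_Z2; rewrite /to_triple; move: (normalised_111 c).
move: (normalised c) => {}c c111 Zc.
set phi := fun a => _.
have phiM (x y : pi1 V) : phi (x ** y) = phi x + phi y.
  by apply: (coc_ker_hom Zc c111); apply: (proj2_sig y).
have phi_act p a : phi (pi1_act p a) = actM p (phi a).
  rewrite -(bar_s0 p) /phi pi1val_act.
  by apply: (coc_ker_act Zc c111); exact: pi1valP.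
split=> //; split=> //; split.
  move=> q p H; rewrite (tau_cpt2 Zc c111 H) (corr_cpt2 phiM phi_act H).
  by rewrite addr0.
move=> r q p; have [a Ea ->] := z3E r q p.
rewrite phiM -(gd2_corr phiM phi_act) /phi -(gd2_tau Zc c111 Ea).
rewrite /gd2 !actMD; zmod.
Qed.

Lemma to_triple_add c c' :
  to_triple (C2_xmod_add c c') = C2_triple_add (to_triple c) (to_triple c').
Proof.
rewrite /to_triple /C2_triple_add /=; congr pair.
  apply: functional_extensionality => a.
  by rewrite /normalised /C2_xmod_add !actMD; zmod.
apply: functional_extensionality => q; apply: functional_extensionality => p.
rewrite /tau /corr /normalised /C2_xmod_add !actME; zmod.
Qed.

Lemma xd1_const (e : xG V -> M) (u : M) m h g :
  xd1 actM (fun k => e k + u) m h g = xd1 actM e m h g + actM (bar h) u.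
Proof. rewrite /xd1 actMD; zmod. Qed.

Lemma to_triple_B2_of c : B2_xmod actM c -> B2_triple actM (to_triple c).
Proof.
move=> [e He].
(* Normalising [c] amounts to making its primitive vanish at [gone]; then phi vanishes and tau is
   the coboundary of e0 o s^0. *)
pose e0 g := e g - e gone.
have E0 m h g : normalised c m h g = xd1 actM e0 m h g.
  rewrite /normalised !He xd1_const {2}/xd1 mu1 !gmul1g actM1 subrr add0r actMN; zmod.
have e01 : e0 gone = 0 by rewrite /e0 subrr.
rewrite /to_triple; move: (normalised c) E0 => {He}c Ec.
set phi := fun a => _.
have phi0 a : phi a = 0.
  have ka : mu (pi1val a) = gone by exact: pi1valP.
  by rewrite /phi Ec /xd1 ka !gmul1g e01 actM0 subrr addr0.
have tauE q p : tau c q p + corr phi q p = gd1M (fun p => e0 (s0 p)) q p.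
  rewrite corr0 // /tau !Ec /xd1 mu_Z mu1 !(gmul1g, gmulg1) e01 !bar_s0 /gd1.
  rewrite actM0; zmod.
split=> //; split; last by exists (fun p => e0 (s0 p)).
move=> q p H; rewrite tauE /gd1.
by case: H => ->; rewrite s0_1 e01 ?(gmul1g, gmulg1, actM1, actM0); zmod.
Qed.

Lemma to_triple_B2 c : Z2_xmod actM c -> B2_triple actM (to_triple c) -> B2_xmod actM c.
Proof.
move=> Zc0; have := normalised_Z2 Zc0; rewrite /to_triple.
suff H : forall c0 : C2_xmod V M, c0 gone gone gone = 0 -> Z2_xmod actM c0 ->
    (forall a, c0 (pi1val a) gone gone = 0) ->
    (exists eps, forall q p, tau c0 q p = gd1M eps q p) ->
    B2_xmod actM c0.
  move=> Zc [phi0 [_ [eps Heps]]].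
  have [|e He] := H _ (normalised_111 c) Zc phi0.
    by exists eps => q p; rewrite -Heps corr0 ?addr0.
  (* Adding the constant back to the primitive undoes the normalisation. *)
  exists (fun k => e k + c gone gone gone) => m h g.
  by rewrite xd1_const -He /normalised subrK.
move=> {Zc0}c c111 Zc phi0 [eps Heps].
have cker x y k : mu x = mu y -> c x k gone = c y k gone.
  move=> /mu_eq [a ->].
  by rewrite (coc_mulM Zc c111) (coc_ker Zc c111 _ (pi1valP a)) phi0 add0r.
(* This value is forced at g = mu(m_g) s^0(gbar) by the two requirements [e_mu] and [e_s0]. By
   [cker] the choice of m_g does not matter. *)
pose e g := c (l g) (s0 (bar g)) gone + eps (bar g).
have e_mu m h : e (mu m ** h) = c m h gone + e h.
  rewrite /e bar_muM (cker _ _ _ (mu_lift_mul m h)) (coc_mulM Zc c111) mu_lift.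
  by rewrite addrA.
have e_s0 p : e (s0 p) = eps p.
  rewrite /e lift_s0 bar_s0.
  by rewrite (coc_1k1 Zc c111) add0r.
have e_mul h g : e (h ** g) = e h + actM (bar h) (e g) - c gone h g.
  (* Moving s^0(hbar) to the right past mu(m_g) leaves a product of two sections, to which [Heps]
     applies. *)
  have -> : h ** g = mu (l h ** xact (s0 (bar h)) (l g)) ** (s0 (bar h) ** s0 (bar g)).
    rewrite -[in LHS](mu_lift h) -[in LHS](mu_lift g) muM -!gmulA.
    by rewrite (gmulA (mu (xact _ _))) mu_act -!gmulA.
  rewrite e_mu -mu_Z e_mu mu_Z e_s0 (coc_mulM Zc c111).
  have := coc_act Zc (s0 (bar h)) (l g) (s0 (bar g)).
  rewrite mu_lift bar_s0 => ->.
  have -> : mu (xact (s0 (bar h)) (l g)) ** (s0 (bar h) ** s0 (bar g)) = s0 (bar h) ** g.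
    by rewrite gmulA mu_act -gmulA mu_lift.
  rewrite (coc_mulG Zc c111) mu_lift /e actMD.
  have := Heps (bar h) (bar g); rewrite /tau /gd1 => H.
  apply: eq_of_subr H _; zmod.
exists e => m h g.
rewrite (coc_split Zc c111) /xd1 e_mu e_mul; zmod.
Qed.

(** * Rebuilding a 2-cocycle of V from a pair *)

Section Surjectivity.
Variables (phi : pi1 V -> M) (t : pi0 V -> pi0 V -> M).
Hypotheses (phiM : forall x y : pi1 V, phi (x ** y) = phi x + phi y)
  (phi_act : forall p a, phi (pi1_act p a) = actM p (phi a))
  (t_cpt : cpt2 gone 0 t)
  (dt : forall r q p (a : pi1 V), pi1val a = post_z3 s0 s1 r q p ->
     phi a = gd2M t r q p).

Lemma ker_quot x : ker_mu (x ** ginv (s1 (mu x))).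
Proof. by rewrite /ker_mu muM muV mu_s1 gmulgV. Qed.

(* An extension of phi to all of M_V, affine over pi_1, vanishing on the section s1. *)
Definition psi x : M := phi (exist _ _ (ker_quot x)).

Lemma psi_ker (a : pi1 V) x : psi (pi1val a ** x) = phi a + psi x.
Proof.
rewrite /psi -phiM; congr phi; apply: pi1val_inj => /=.
have -> : mu (pi1val a ** x) = mu x by rewrite muM (proj2_sig a : mu _ = _) gmul1g.
by rewrite gmulA.
Qed.

Lemma psi_s1 g : mu (s1 g) = g -> psi (s1 g) = 0.
Proof.
move=> E; rewrite -(character1 phiM) /psi; congr phi; apply: pi1val_inj => /=.
by rewrite E gmulgV.
Qed.

Lemma psi_lift g : psi (l g) = 0.
Proof. by apply: psi_s1; rewrite mu_liftE. Qed.

Lemma psi_Z q p : psi (Z q p) = 0.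
Proof. by apply: psi_s1; rewrite mu_s1_bar // barM !bar_s0. Qed.

Lemma psi1 : psi gone = 0.
Proof. by rewrite -[X in psi X]s1_1 psi_s1 // s1_1 mu1. Qed.

(** Elements with equal image differ by a central [a] in pi_1, which contributes [phi a] to both
    differences. Such difference rules stand in for multiplicativity of [psi]. *)
Lemma psi_mul u v x y : mu x = mu y ->
  psi (u ** x ** v) - psi (u ** y ** v) = psi x - psi y.
Proof.
move=> /mu_eq [a ->].
rewrite -!gmulA (ker_mulCA _ _ (pi1valP a)) !psi_ker; zmod.
Qed.

Lemma psi_mull u x y : mu x = mu y -> psi (u ** x) - psi (u ** y) = psi x - psi y.
Proof. by move=> /(psi_mul u gone); rewrite !gmulg1. Qed.
Lemma psi_mulr v x y : mu x = mu y -> psi (x ** v) - psi (y ** v) = psi x - psi y.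
Proof. by move=> /(psi_mul gone v); rewrite !gmul1g. Qed.

Lemma psi_act g x y : mu x = mu y ->
  psi (xact g x) - psi (xact g y) = actM (bar g) (psi x - psi y).
Proof.
move=> /mu_eq [a ->].
rewrite actxM -pi1val_act !psi_ker phi_act !actME; zmod.
Qed.

(** By [mu_lift_mulG] the argument of [psi] is a pi_1-multiple of [l (h ** g)], where [psi]
    vanishes; so the [psi] term is phi of the multiplicative defect of [l]. *)
Definition gam h g : M :=
  t (bar h) (bar g) - psi (l h ** xact (s0 (bar h)) (l g) ** Z (bar h) (bar g)).

Definition of_triple : C2_xmod V M := fun m h g => psi (m ** l h) + gam h g.

(** This lemma, [gam_mulG], [gam_act] and [gam_gd2] are the analogues for [of_triple] of [coc_mulM],
    [coc_mulG], [coc_act] and [coc_gd2]; [of_triple_Z2] adds them up. *)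
Lemma psi_mulM m n k : psi (m ** n ** l k) = psi (m ** l (mu n ** k)) + psi (n ** l k).
Proof.
have := psi_mull m (mu_lift_mul n k); rewrite psi_lift gmulA => H.
apply: eq_of_subr (esym H) _; zmod.
Qed.

Lemma gam_mulG n k h :
  psi (n ** l (k ** h)) - psi (n ** l k) + gam (mu n ** k) h - gam k h = 0.
Proof.
rewrite /gam bar_muM.
set W := xact _ _.
have E1 := psi_mulr (W ** Z (bar k) (bar h)) (mu_lift_mul n k).
have E2 := psi_mull n (mu_lift_mulG k h).
rewrite -/W !psi_lift !gmulA in E1 E2.
apply: eq_of_subr (congr2 +%R (esym E1) E2) _; zmod.
Qed.

Lemma gam_act k m h : psi (xact k m ** l (k ** h)) =
  actM (bar k) (psi (m ** l h)) - gam k (mu m ** h) + gam k h.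
Proof.
rewrite /gam bar_muM -!act_lift.
set W := Z _ _.
have E1 := psi_act k (mu_lift_mul m h).
have E2 : mu (xact k (l (mu m ** h))) = mu (xact k (m ** l h)).
  by rewrite !xmu_act mu_lift_mul.
have {}E2 := psi_mulr (l k ** W) E2.
have E3 := psi_mull (xact k m) (mu_lift_mulG k h).
rewrite -act_lift -/W in E3.
rewrite !psi_lift !actME !actxM !gmulA in E1 E2 E3 *.
apply: eq_of_subr (congr2 +%R (esym E1) (congr2 +%R (esym E2) E3)) _; zmod.
Qed.

Lemma gam_gd2 k h g :
  gam k h - gam k (h ** g) + gam (k ** h) g - actM (bar k) (gam h g) = 0.
Proof.
rewrite /gam !barM.
set r := bar k; set q := bar h; set p := bar g.
have [a Ea _] := z3E r q p.
have Et := dt Ea.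
have E1 := psi_mulr (xact (s0 (r ** q)) (l g) ** Z (r ** q) p) (mu_lift_mulG k h).
have E2 := psi_act k (mu_lift_mulG h g).
have E3 : mu (xact k (l (h ** g))) =
    mu (xact k (l h ** xact (s0 q) (l g) ** Z q p)).
  by rewrite !xmu_act mu_lift_mulG.
have {}E3 := psi_mulr (l k ** Z r (q ** p)) E3.
have Z1 : Z r q ** xact (s0 (r ** q)) (l g) =
    xact (s0 r) (xact (s0 q) (l g)) ** Z r q.
  by rewrite -actMx -mu_Z actMx peiffer.
(* The coordinates of (kh)g and k(hg) differ by the Postnikov value [a], and [Et] makes [phi a]
   cancel against the differential of [t]. *)
have E4 : psi (l k ** xact (s0 r) (l h) ** Z r q ** xact (s0 (r ** q)) (l g) ** Z (r ** q) p)
    = phi a + psi (xact k (l h ** xact (s0 q) (l g) ** Z q p) ** l k ** Z r (q ** p)).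
  have ka : ker_mu (pi1val a) by exact: pi1valP.
  have EZ : Z r q ** Z (r ** q) p =
      pi1val a ** (xact (s0 r) (Z q p) ** Z r (q ** p)).
    by rewrite Ea /post_z3 -!gmulA mulKg gmulVg gmulg1.
  rewrite act_lift -/r !actxM -psi_ker; congr psi.
  rewrite -!gmulA (gmulA (Z r q)) Z1 -gmulA EZ.
  by rewrite !(ker_mulCA _ _ ka).
rewrite !psi_lift -/r -/q -/p -?act_lift !gmulA !actME in E1 E2 E3 E4 *.
rewrite /gd2 in Et.
apply: eq_of_subr (congr2 +%R (congr2 +%R (esym Et) (esym E4))
  (congr2 +%R (esym E1) (congr2 +%R E2 E3))) _; zmod.
Qed.

Lemma of_triple_Z2 : Z2_xmod actM of_triple.
Proof.
move=> m' n k m h g; rewrite /xd2 /of_triple.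
have E1 := psi_mulM m' n k.
have E2 := psi_mulM n (xact k m) (k ** h).
have E3 := gam_mulG n k (mu m ** h).
have E4 := gam_act k m h.
have E5 := gam_gd2 k h g.
have muE : mu (xact k m) ** (k ** h) = k ** (mu m ** h).
  by rewrite gmulA mu_act -gmulA.
rewrite muE in E2.
rewrite actMD.
apply: eq_of_subr (congr2 +%R (congr2 +%R (esym E1) E2)
  (congr2 +%R E3 (congr2 +%R E4 E5))) _; zmod.
Qed.

Lemma gam_1r h : gam h gone = 0.
Proof.
rewrite /gam (@t_cpt _ _ (or_intror erefl)) Zq1 gmulg1.
have -> : l gone = gone by rewrite -{1}s0_1 lift_s0.
by rewrite actx1 gmulg1 psi_lift subrr.
Qed.

Lemma of_triple_tau q p : tau of_triple q p = t q p.
Proof.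
rewrite /tau /of_triple gam_1r /gam !lift_s0 !bar_s0 actx1 !(gmul1g, gmulg1).
by rewrite psi_Z psi1 addr0 add0r add0r subr0.
Qed.

Lemma of_triple_phi (a : pi1 V) : of_triple (pi1val a) gone gone = phi a.
Proof.
rewrite /of_triple gam_1r psi_ker psi_lift; zmod.
Qed.

End Surjectivity.

Lemma to_triple_surj (y : C2_triple (pi0 V) (pi1 V) M) :
  Z2_triple (@pi1_act V) z3 actM y ->
  exists2 c, Z2_xmod actM c & to_triple c = y.
Proof.
case: y => phi t [phiM [phi_act [t_cpt dt]]].
(* [to_triple] adds [corr] back; removing it trades phi o z3 for phi o z_V as the differential. *)
pose t' q p := t q p - corr phi q p.
have t'_cpt : cpt2 gone 0 t'.
  by move=> q p H; rewrite /t' t_cpt // (corr_cpt2 phiM phi_act H) subrr.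
have dt' r q p (a : pi1 V) : pi1val a = post_z3 s0 s1 r q p -> phi a = gd2M t' r q p.
  move=> Ea; have [a' Ea' E] := z3E r q p.
  have Ez := dt r q p.
  have -> : a = a' by apply: pi1val_inj; rewrite Ea Ea'.
  rewrite E phiM -(gd2_corr phiM phi_act) in Ez.
  apply: eq_of_subr Ez _; rewrite /gd2 /t' !actME; zmod.
exists (of_triple phi t'); first exact: of_triple_Z2.
have E : normalised (of_triple phi t') = of_triple phi t'.
  do 3 apply: functional_extensionality => ?.
  rewrite /normalised (of_triple_phi phiM t'_cpt gone) (character1 phiM) actM0 subr0.
  by [].
have Ephi : (fun a => of_triple phi t' (pi1val a) gone gone) = phi.
  by apply: functional_extensionality => a; apply: of_triple_phi.
rewrite /to_triple E Ephi; congr pair.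
do 2 apply: functional_extensionality => ?.
rewrite of_triple_tau // /t' subrK; by [].
Qed.

End Triple.

End Sections.

(** * The isomorphism for crossed modules *)

Lemma xmod_H2_iso (z3 : pi0 V -> pi0 V -> pi0 V -> pi1 V) : class_is_k3 z3 ->
  quot_iso (@C2_xmod_add V M) (Z2_xmod actM) (B2_xmod actM)
    (@C2_triple_add (pi0 V) (pi1 V) M)
    (Z2_triple (@pi1_act V) z3 actM) (B2_triple actM).
Proof.
move=> [s0 [s1 [Hs [b [db_cpt dbE]]]]].
exists (to_triple s0 s1 b); split; first exact: to_triple_Z2 dbE.
split; first by move=> c c' _ _; apply: to_triple_add.
split.
  by move=> c Zc; split; [apply: to_triple_B2 | apply: to_triple_B2_of].
move=> y /(to_triple_surj Hs db_cpt dbE) [c Zc Ec].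
(* [to_triple] attains [y] exactly, so the correcting coboundary is zero. *)
exists c; split=> //; exists (fun _ => 0, fun _ _ => 0); split.
  split=> //; split=> //; exists (fun _ => 0) => q p.
  by rewrite /gd1 actM0 subrr addr0.
rewrite Ec; case: y {Ec} => phi t; rewrite /C2_triple_add /=; congr pair.
  by apply: functional_extensionality => a; rewrite addr0.
by do 2 apply: functional_extensionality => ?; rewrite addr0.
Qed.

End Module.
End CrossedModule.

(** * The segment T^1 G satisfies the crossed module axioms *)

Section SimplicialGroup.
Variable G : sgrp.
Local Notation d n i := (@sface G n i).
Local Notation s n i := (@sdegen G n i).
Local Notation rep := (@T1rep G).

Lemma faceM n i (x y : sG G n.+1) : (i <= n.+1)%N -> d n i (x ** y) = d n i x ** d n i y.
Proof. by move=> le_in; apply: sface_hom. Qed.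
Lemma faceV n i (x : sG G n.+1) : (i <= n.+1)%N -> d n i (ginv x) = ginv (d n i x).
Proof. by move=> le_in; apply: hom_inv; apply: sface_hom. Qed.
Lemma degenM n i (x y : sG G n) : (i <= n)%N -> s n i (x ** y) = s n i x ** s n i y.
Proof. by move=> le_in; apply: sdegen_hom. Qed.
Lemma degen1 n i : (i <= n)%N -> s n i gone = gone.
Proof. by move=> le_in; apply: hom_one; apply: sdegen_hom. Qed.

Lemma N1val_face (y : N1grp G) : d 0 1 (N1val y) = gone.
Proof. exact: (proj2_sig y). Qed.

Definition T1cl (x : N1grp G) : T1M G := qcl _ x.

Lemma N1val_inj (x y : N1grp G) : N1val x = N1val y -> x = y.
Proof. exact: sig_eq. Qed.

Lemma T1cl_rep m : T1cl (rep m) = m.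
Proof. exact: qcl_rep. Qed.

Lemma T1cl_eqP (x y : N1grp G) : T1cl x = T1cl y <->
  exists b : sG G 2, N2pred b /\ d 1 0 b = N1val x ** ginv (N1val y).
Proof. exact: (qcl_eqP (@B1_1 G) (@B1_M G) (@B1_V G)). Qed.

Lemma T1clM (x y : N1grp G) : T1cl x ** T1cl y = T1cl (x ** y) :> T1M G.
Proof. exact: (qmulE (@B1_1 G) (@B1_M G) (@B1_V G) (@B1_J G)). Qed.

Lemma T1mu_T1cl (x : N1grp G) : T1mu (T1cl x) = d 0 0 (N1val x).
Proof. exact: T1mu_cl. Qed.

Definition conjN1 g (y : N1grp G) : N1grp G := exist (@N1pred G) _ (N1_conj g y).

Lemma N1val_conj g y :
  N1val (conjN1 g y) = s 0 0 g ** N1val y ** ginv (s 0 0 g).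
Proof. by []. Qed.
Lemma N1valM (x y : N1grp G) : N1val (x ** y) = N1val x ** N1val y.
Proof. by []. Qed.
Lemma N1valV (x : N1grp G) : N1val (ginv x) = ginv (N1val x).
Proof. by []. Qed.
Definition N1valE := (N1val_conj, N1valM, N1valV).

Lemma T1act_cl g y : T1act g (T1cl y) = T1cl (conjN1 g y).
Proof.
have /T1cl_eqP [b [[Hb1 Hb2] Hb0]] : T1cl (rep (T1cl y)) = T1cl y by apply: T1cl_rep.
(* Conjugating [b] by a doubly degenerate element stays in N_2 and conjugates its d_0 by s_0(g). *)
apply/T1cl_eqP; exists (s 1 0 (s 0 0 g) ** b ** ginv (s 1 0 (s 0 0 g))).
rewrite /N2pred !faceM // !faceV // Hb1 Hb2 Hb0 !gmulg1 !gmulgV; split=> //.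
by rewrite s_ds_eq // !N1valE !invMg invgK -!gmulA mulKg.
Qed.

Lemma T1_axioms : xmod_axioms (T1 G).
Proof.
have ext (x y : N1grp G) : N1val x = N1val y -> T1cl x = T1cl y by move=> /N1val_inj ->.
split; last split; last split.
- move=> g m n; change (T1act g (m ** n : T1M G) = T1act g m ** T1act g n).
  rewrite -(T1cl_rep m) -(T1cl_rep n) T1clM !T1act_cl T1clM.
  by apply: ext; rewrite !N1valE -!gmulA mulKg.
- move=> m; rewrite -[in RHS](T1cl_rep m) -(T1cl_rep m) /= T1act_cl.
  by apply: ext; rewrite !N1valE degen1 // invg1 gmulg1 gmul1g T1cl_rep.
- move=> g h m; rewrite -(T1cl_rep m) /= !T1act_cl.
  by apply: ext; rewrite !N1valE degenM // invMg -!gmulA.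
- move=> n m.
  change (T1act (T1mu n) m = (n ** m : T1M G) ** ginv (n : T1M G)).
  rewrite -(T1cl_rep m) -(T1cl_rep n) T1act_cl T1mu_T1cl.
  set x := rep n; set y := rep m.
  have -> : ginv (T1cl x) = T1cl (ginv x) :> T1M G.
    exact: (qinvE (@B1_1 G) (@B1_M G) (@B1_V G) (@B1_J G)).
  rewrite (T1clM x y) T1clM; apply/T1cl_eqP.
  pose z := N1val (x ** y ** ginv x).
  have dz : d 0 1 z = gone by apply: N1val_face.
  (* Conjugating s_0(y) by s_1(x) gives d_0 equal to y conjugated by s_0(d_0 x), and d_1 equal to z.
     Dividing by s_0(z) kills d_1; d_2 is trivial because d_1 kills y and z. *)
  exists (s 1 1 (N1val x) ** s 1 0 (N1val y) ** ginv (s 1 1 (N1val x)) ** ginv (s 1 0 z)).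
  split; first split.
  + by rewrite !faceM // !faceV // !s_ds_eq // !s_ds_eq1 // /z !N1valE gmulgV.
  + rewrite !faceM // !faceV // s_ds_eq1 // !(s_ds_gt G 0 2 0) // dz N1val_face.
    by rewrite degen1 // invg1 !gmulg1 gmulgV.
  by rewrite !faceM // !faceV // !s_ds_eq // (s_ds_lt G 0 0 1).
Qed.

(** * Comparison of 2-cochains of G and of T^1 G *)

Section Cochains.
Variables (M : zmodType) (actM : spi0 G -> M -> M) (Mmod : is_module actM).

(** Based on the splitting of G_1 as N_1 times s_0(G_0). The chosen representative of m is
    immaterial on cocycles, by [coc_cl]. *)
Definition restrict (c : C2_sgrp G M) : C2_xmod (T1 G) M :=
  fun m h g => c (N1val (rep m) ** s 0 0 h) g.

Lemma N1_part_proof (x : sG G 1) : N1pred (x ** ginv (s 0 0 (d 0 1 x))).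
Proof. by rewrite /N1pred faceM // faceV // s_ds_eq1 // gmulgV. Qed.

Definition N1_part x : N1grp G := exist (@N1pred G) _ (N1_part_proof x).

Lemma N1val_part x : N1val (N1_part x) = x ** ginv (s 0 0 (d 0 1 x)).
Proof. by []. Qed.

Definition extend (c : C2_xmod (T1 G) M) : C2_sgrp G M :=
  fun x g => c (T1cl (N1_part x)) (d 0 1 x) g.

Lemma restrict_extend c : restrict (extend c) = c.
Proof.
do 3 apply: functional_extensionality => ?.
rewrite /restrict /extend.
set m := (X in c _ _ _ = c X _ _); set h := (X in c _ _ _ = c _ X _).
have E : d 0 1 (N1val (rep m) ** s 0 0 h) = h.
  by rewrite faceM // N1val_face s_ds_eq1 // gmul1g.
have -> : N1_part (N1val (rep m) ** s 0 0 h) = rep m.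
  by apply: N1val_inj; rewrite N1val_part E -gmulA gmulgV gmulg1.
by rewrite E T1cl_rep.
Qed.

Lemma extend_Z2 c : Z2_xmod actM c -> Z2_sgrp actM (extend c).
Proof.
move=> Zc g2 g1 g0; rewrite /sd2 /extend.
set x0 := d 1 0 g2; set x1 := d 1 1 g2; set x2 := d 1 2 g2.
pose k := d 0 1 x2; pose h := d 0 1 g1.
have d1x0 : d 0 1 x0 = d 0 0 x2 by rewrite /x0 /x2 (s_dd G 0 0 2).
have d1x1 : d 0 1 x1 = k by rewrite /k /x1 /x2 (s_dd G 0 1 2).
have d0x1 : d 0 0 x1 = d 0 0 x0 by rewrite /x1 /x0 (s_dd G 0 0 1).
have mu_part x : T1mu (T1cl (N1_part x)) ** d 0 1 x = d 0 0 x.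
  by rewrite T1mu_T1cl N1val_part faceM // faceV // s_ds_eq // -gmulA gmulVg gmulg1.
have := Zc (T1cl (N1_part x0)) (T1cl (N1_part x2)) k (T1cl (N1_part g1)) h g0.
rewrite /xd2 /= !mu_part /sbr2 -/x2 -/k -/h d1x0 d1x1 faceM // -/k -/h.
suff [-> ->] : T1cl (N1_part x1) = T1cl (N1_part x0) ** T1cl (N1_part x2) :> T1M G /\
    T1cl (N1_part (x2 ** g1)) = T1cl (N1_part x2) ** T1act k (T1cl (N1_part g1)) :> T1M G.
  by [].
rewrite T1act_cl !T1clM; split.
  symmetry; apply/T1cl_eqP.
  (* The factor s_1(x2) makes d_2 of [y] trivial; dividing [y] by s_0(d_1 y) then kills d_1 as well
     and keeps d_2 trivial. *)
  pose y := g2 ** ginv (s 1 1 x2).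
  have d1y : d 1 1 y = x1 ** ginv x2 by rewrite /y faceM // faceV // s_ds_eq.
  have dd1y : d 0 1 (x1 ** ginv x2) = gone by rewrite faceM // faceV // d1x1 gmulgV.
  exists (y ** ginv (s 1 0 (d 1 1 y))); split; first split.
  + by rewrite faceM // faceV // s_ds_eq1 // gmulgV.
  + rewrite faceM // faceV // (s_ds_gt G 0 2 0) // d1y dd1y degen1 // invg1 gmulg1.
    by rewrite /y faceM // faceV // s_ds_eq1 // gmulgV.
  rewrite faceM // faceV // s_ds_eq // d1y /y faceM // faceV // (s_ds_lt G 0 0 1) //.
  rewrite N1valM !N1val_part d1x0 d1x1 -/k -/x0 !invMg !invgK -!gmulA mulKg.
  by [].
congr (T1cl _); apply: N1val_inj.
rewrite !N1valE !N1val_part faceM // -/k -/h degenM //.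
by rewrite invMg -!gmulA mulKg.
Qed.

Section Cocycle.
Variables (c : C2_sgrp G M) (Zc : Z2_sgrp actM c).

(* The cocycle condition on a 2-simplex with faces [b ** x], [x], [s0 (d1 x)]
   shows that c is already a function of the crossed module segment. *)
Lemma coc_B1 (b : sG G 2) x y : N2pred b -> c (d 1 0 b ** x) y = c x y.
Proof.
move=> [Hb1 Hb2].
have := Zc (b ** s 1 0 x) (s 0 0 y) gone.
have := Zc (s 1 0 x) (s 0 0 y) gone.
rewrite /sd2 !faceM // Hb1 Hb2 !gmul1g !s_ds_eq // !s_ds_eq1 // /sbr2 faceM // Hb2 gmul1g.
move=> E1 E2; apply: eq_of_subr (congr2 +%R E2 (esym E1)) _; zmod.
Qed.

Lemma coc_cl (x y : N1grp G) z g : T1cl x = T1cl y ->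
  c (N1val x ** z) g = c (N1val y ** z) g.
Proof.
move=> /T1cl_eqP [b [Nb Hb]].
have -> : N1val x = d 1 0 b ** N1val y by rewrite Hb -gmulA gmulVg gmulg1.
by rewrite -gmulA coc_B1.
Qed.

Lemma restrict_Z2 : Z2_xmod actM (restrict c).
Proof.
move=> p n k m h g; rewrite /xd2 /restrict.
set p' := N1val (rep p); set n' := N1val (rep n); set m' := N1val (rep m).
(* This 2-simplex has d_0 = p' s_0(mu(n) k), d_1 = p' n' s_0(k) and d_2 = n' s_0(k), the first
   arguments in the crossed module differential. *)
have := Zc (s 1 0 p' ** s 1 1 n' ** s 1 1 (s 0 0 k)) (m' ** s 0 0 h) g.
rewrite /sd2 /sbr2 !faceM // !s_ds_eq // !s_ds_eq1 // !(s_ds_lt G 0 0 1) //.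
rewrite !(s_ds_gt G 0 2 0) // !N1val_face !s_ds_eq // !s_ds_eq1 // degen1 // !gmul1g.
have -> : c (N1val (rep (p ** n)) ** s 0 0 k) (h ** g) = c (p' ** n' ** s 0 0 k) (h ** g).
  rewrite (@coc_cl _ (rep p ** rep n)) // T1cl_rep -T1clM !T1cl_rep; by [].
have -> : c (N1val (rep (n ** T1act k m)) ** s 0 0 (k ** h)) g =
    c (n' ** s 0 0 k ** (m' ** s 0 0 h)) g.
  rewrite (@coc_cl _ (rep n ** conjN1 k (rep m))); last first.
    by rewrite T1cl_rep -T1clM -T1act_cl !T1cl_rep.
  by congr (c _ g); rewrite degenM // !N1valE -!gmulA mulKg.
have -> : @xmu (T1 G) n = d 0 0 n' by [].
have -> : @xmu (T1 G) m = d 0 0 m' by [].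
by rewrite degenM // !gmulA.
Qed.

(** Both complexes have Map(G_0, M) as 1-cochains, so the same [e] serves in both directions. *)
Lemma restrict_B2 : B2_xmod actM (restrict c) <-> B2_sgrp actM c.
Proof.
split=> -[e He]; exists e.
  move=> x g.
  have -> : c x g = restrict c (T1cl (N1_part x)) (d 0 1 x) g.
    rewrite /restrict (@coc_cl _ (N1_part x)) ?T1cl_rep //.
    by rewrite N1val_part -gmulA gmulVg gmulg1.
  rewrite He /xd1 /sd1 /sbr1 /= T1mu_T1cl N1val_part faceM // faceV // s_ds_eq //.
  by rewrite -gmulA gmulVg gmulg1.
move=> m h g; rewrite /restrict He /sd1 /xd1 /sbr1 !faceM // N1val_face.
by rewrite s_ds_eq // s_ds_eq1 // gmul1g.
Qed.

End Cocycle.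

Lemma sgrp_H2_iso (z3 : spi0 G -> spi0 G -> spi0 G -> spi1 G) :
  @class_is_k3 (T1 G) z3 ->
  quot_iso (@C2_sgrp_add G M) (Z2_sgrp actM) (B2_sgrp actM)
    (@C2_triple_add (spi0 G) (spi1 G) M)
    (Z2_triple (@pi1_act (T1 G)) z3 actM) (B2_triple actM).
Proof.
move=> /(xmod_H2_iso T1_axioms Mmod) [F [FZ [FD [FB Fsurj]]]].
exists (fun c => F (restrict c)); split.
  by move=> c /restrict_Z2; apply: FZ.
split; first by move=> c c' /restrict_Z2 Zc /restrict_Z2; apply: FD.
split.
  by move=> c Zc; rewrite (FB _ (restrict_Z2 Zc)); apply: restrict_B2.
move=> y /Fsurj [c [Zc Ey]]; exists (extend c); split; first exact: extend_Z2.
by rewrite restrict_extend.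
Qed.

End Cochains.
End SimplicialGroup.

Theorem theorem5p4 :
  (* (a) crossed modules *)
  (forall (V : xmod) (M : zmodType) (actM : pi0 V -> M -> M)
          (z3 : pi0 V -> pi0 V -> pi0 V -> pi1 V),
     xmod_axioms V ->
     is_module actM ->
     Z3cpt (@pi1_act V) z3 ->
     class_is_k3 z3 ->
     quot_iso (@C2_xmod_add V M) (Z2_xmod actM) (B2_xmod actM)
              (@C2_triple_add (pi0 V) (pi1 V) M)
              (Z2_triple (@pi1_act V) z3 actM) (B2_triple actM))
  /\
  (* (b) simplicial groups *)
  (forall (G : sgrp) (M : zmodType) (actM : spi0 G -> M -> M)
          (z3 : spi0 G -> spi0 G -> spi0 G -> spi1 G),
     is_module actM ->
     Z3cpt (@pi1_act (T1 G)) z3 ->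
     @class_is_k3 (T1 G) z3 ->
     quot_iso (@C2_sgrp_add G M) (Z2_sgrp actM) (B2_sgrp actM)
              (@C2_triple_add (spi0 G) (spi1 G) M)
              (Z2_triple (@pi1_act (T1 G)) z3 actM) (B2_triple actM)).
Proof.
split.
  by move=> V M actM z3 Vax Mmod _; apply: xmod_H2_iso.
by move=> G M actM z3 Mmod _; apply: sgrp_H2_iso.
Qed.
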